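(* Let $\ell>0$, let $\mu_0,\mu_1\in\mathcal M(X)$, and let $H_{01}$ be a minimizer of $\mathcal{LET}_\ell(\,\cdot\,;\mu_0,\mu_1)$. Then $$H_{01}(X\times X)\le\sqrt{\mu_0'(X)\mu_1'(X)}\le\sqrt{\mu_0(X)\mu_1(X)},$$ where $(\mu_0',\mu_1')$ is the reduced couple of $(\mu_0,\mu_1)$. Furthermore, $$H_{01}(A\times X)\le\sqrt{\mu_0'(A)\,\mu_1'\big(A_{\frac{\pi}{2\ell}}\big)}\qquad\text{for all Borel sets }A\subset X,$$ where $A_b=\{y\in X:\ \exists\,x\in A\text{ with }\mathsf d_X(x,y)\le b\}$. Finally, if $X\subset\mathbb R^d$, $\mu_0,\mu_1\ll\mathcal L$ with $\mathcal L$ the Lebesgue measure, and $T:X\to X$ is a function whose graph is the support of $H_{01}$, then $$H_{01}(A\times T(A))\le\sqrt{\mu_0'(A)\,\mu_1'(T(A))}\qquad\text{for all Borel sets }A\subset X.$$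
   Context: $(X,\mathsf d_X)$ is a geodesic, Polish metric space and $\mathcal M(X)$ the set of nonnegative finite Borel measures on $X$ (in the last claim $X\subset\mathbb R^d$ with the Euclidean distance). Let $F(r)=r\log r-r+1$ for $r\ge0$ (with $F(0)=1$) and $L_\ell(R)=-2\log(\cos(\ell R))$ if $\ell R<\pi/2$, $L_\ell(R)=+\infty$ otherwise. For $H_{01}\in\mathcal M(X\times X)$ with marginals $\eta_i=(\pi^i)_\sharp H_{01}=\sigma_i\mu_i\ll\mu_i$, set $\mathcal{LET}_\ell(H_{01};\mu_0,\mu_1)=\int_XF(\sigma_0)\,d\mu_0+\int_XF(\sigma_1)\,d\mu_1+\iint L_\ell(\mathsf d_X(x_0,x_1))\,dH_{01}$; minimization is over all $H_{01}$ whose marginals satisfy $(\pi^i)_\sharp H_{01}\ll\mu_i$. Reduced couple: $\mu_i'$ is the restriction of $\mu_i$ to $A_i'=\{x\in X:\ \ell\,\mathrm{dist}(x,\mathrm{supp}(\mu_{1-i}))<\pi/2\}$, $i=0,1$. Measures of sets such as $A_b$ and $T(A)$ are understood with respect to the completed measures. *)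

(* Defs.v *)
From HB Require Import structures.
From mathcomp Require Import all_boot all_order all_algebra.
From mathcomp Require Import all_classical all_reals all_analysis.
From mathcomp Require Import measurable_realfun.
Set Implicit Arguments.
Unset Strict Implicit.
Unset Printing Implicit Defensive.
Import Order.TTheory GRing.Theory Num.Theory.
Import numFieldNormedType.Exports.
Local Open Scope classical_set_scope.
Local Open Scope ring_scope.

#[short(type="completeMetricType")]
HB.structure Definition CompleteMetric (R : numDomainType) :=
  {T of CompletePseudoMetric R T & PseudoMetric_isMetric R T}.

Definition separable_space (X : topologicalType) : Prop :=
  exists2 D : set X, countable D & dense D.

(* Any two points are joined by a minimizing curve of constant speed,
   parametrized on [0, 1]. *)
Definition geodesic_space (R : realType) (X : metricType R) : Prop :=
  forall x y : X, exists g : R -> X, [/\ g 0 = x, g 1 = y &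
    forall s t, 0 <= s <= 1 -> 0 <= t <= 1 ->
      mdist (g s) (g t) = `|s - t| * mdist x y].

HB.instance Definition _ (X Y : ptopologicalType) :=
  Topological.on (X * Y)%type.

Notation borel X := (g_sigma_algebraType (@open X)).

Notation borel_fmeasure R X := {finite_measure set (borel X) -> \bar R}.

Lemma continuous_borel_measurable (X Y : ptopologicalType) (f : X -> Y) :
  continuous f -> measurable_fun [set: borel X] (f : borel X -> borel Y).
Proof.
move=> /continuousP cf.
apply: (@measurability _ _ (borel X) (borel Y) _ _ (@open Y)) => //.
move=> _ [B oB <-]; rewrite setTI; apply: sub_sigma_algebra; exact: cf.
Qed.

Definition msupport (R : realType) (X : ptopologicalType)
    (mu : set (borel X) -> \bar R) : set X :=
  [set x | forall U : set X, open U -> U x -> (0 < mu U)%E].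

Section marginals.
Context (R : realType) (X : ptopologicalType).
Variable H : borel_fmeasure R (X * X)%type.

Let p0 : borel (X * X)%type -> borel X := @fst X X.
Let p1 : borel (X * X)%type -> borel X := @snd X X.

Let mp0 : measurable_fun setT p0.
Proof.
apply: (@continuous_borel_measurable (X * X)%type X fst) => x.
exact: cvg_fst.
Qed.

Let mp1 : measurable_fun setT p1.
Proof.
apply: (@continuous_borel_measurable (X * X)%type X snd) => x.
exact: cvg_snd.
Qed.

Definition marg0 : set (borel X) -> \bar R := pushforward H p0.
Definition marg1 : set (borel X) -> \bar R := pushforward H p1.

Let marg0_set0 : marg0 set0 = 0%E.
Proof. exact: measure0. Qed.

Let marg0_ge0 A : (0 <= marg0 A)%E.
Proof. exact: measure_ge0. Qed.

Let marg0_sigma_additive : semi_sigma_additive marg0.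
Proof. exact: measure_semi_sigma_additive. Qed.

HB.instance Definition _ := isMeasure.Build _ _ _ marg0
  marg0_set0 marg0_ge0 marg0_sigma_additive.

Let marg0_fin : fin_num_fun marg0.
Proof.
move=> A mA; apply: fin_num_measure.
by rewrite -[X in measurable X]setTI; exact: mp0.
Qed.

HB.instance Definition _ := Measure_isFinite.Build _ _ _ marg0 marg0_fin.

Let marg1_set0 : marg1 set0 = 0%E.
Proof. exact: measure0. Qed.

Let marg1_ge0 A : (0 <= marg1 A)%E.
Proof. exact: measure_ge0. Qed.

Let marg1_sigma_additive : semi_sigma_additive marg1.
Proof. exact: measure_semi_sigma_additive. Qed.

HB.instance Definition _ := isMeasure.Build _ _ _ marg1
  marg1_set0 marg1_ge0 marg1_sigma_additive.

Let marg1_fin : fin_num_fun marg1.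
Proof.
move=> A mA; apply: fin_num_measure.
by rewrite -[X in measurable X]setTI; exact: mp1.
Qed.

HB.instance Definition _ := Measure_isFinite.Build _ _ _ marg1 marg1_fin.
End marginals.

Section reduced.
Context (R : realType) (X : completeMetricType R).
Implicit Types (mu nu : borel_fmeasure R X) (l : R).
Local Open Scope ereal_scope.

(* The infimum over the empty set is +oo. *)
Definition dist_set (A : set X) (x : X) : \bar R :=
  ereal_inf [set (mdist x y)%:E | y in A].

Definition reduced_set l nu : set X :=
  [set x | l%:E * dist_set (msupport nu) x < (pi / 2)%:E].

Lemma measurable_dist_set (A : set X) :
  measurable_fun setT (fun x : borel X => dist_set A x).
Proof.
apply: (measurability _ (ErealGenInftyO.measurableE R)) => //.
move=> _ [_ [r ->] <-]; rewrite setTI; apply: sub_sigma_algebra.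
rewrite openE => x /=; rewrite in_itv/= => /ereal_inf_lt[_ [y Ay <-]].
rewrite lte_fin => xyr.
have e0 : (0 < r - mdist x y)%R by rewrite subr_gt0.
apply: filterS (nbhsx_ballx x _ e0) => z; rewrite ballEmdist/= in_itv/= => xz.
apply: le_lt_trans (_ : (mdist z y)%:E < _).
  by apply: ereal_inf_lbound; exists y.
rewrite lte_fin (le_lt_trans (metric_triangle z x y))//.
by rewrite metric_sym -ltrBrDr.
Qed.

Lemma measurable_reduced_set l nu :
  measurable (reduced_set l nu : set (borel X)).
Proof.
rewrite -[X in measurable X]setTI.
apply: emeasurable_fun_infty_o => //.
by apply: measurable_funeM; exact: measurable_dist_set.
Qed.

(* [reduced_measure l mu0 mu1] and [reduced_measure l mu1 mu0] form the
   reduced couple of [(mu0, mu1)]. *)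
Definition reduced_measure l mu nu : borel_fmeasure R X :=
  mrestr mu (measurable_reduced_set l nu).

Definition thickening (A : set X) (b : R) : set X :=
  [set y | exists2 x, A x & (mdist x y <= b)%R].

End reduced.

Section LET.
Context (R : realType) (X : completeMetricType R).
Implicit Types (mu : borel_fmeasure R X) (H : borel_fmeasure R (X * X)%type).
Local Open Scope ereal_scope.
Local Open Scope charge_scope.

(* Since [ln 0 = 0], this gives [entropy 0 = 1]. *)
Definition entropy (r : R) : R := (r * ln r - r + 1)%R.

Definition cost (l r : R) : \bar R :=
  if (l * r < pi / 2)%R then (- 2 * ln (cos (l * r)))%:E else +oo.

(* The density of [nu] with respect to [mu]; meaningful when [nu `<< mu]. *)
Definition density (nu mu : borel_fmeasure R X) (x : X) : R :=
  fine (('d (charge_of_finite_measure nu) '/d mu) x).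

Definition admissible mu0 mu1 H : Prop :=
  marg0 H `<< mu0 /\ marg1 H `<< mu1.

Definition LET (l : R) mu0 mu1 H : \bar R :=
  \int[mu0]_x (entropy (density (marg0 H) mu0 x))%:E
  + \int[mu1]_x (entropy (density (marg1 H) mu1 x))%:E
  + \int[H]_p cost l (mdist p.1 p.2).

Definition LET_minimizer (l : R) mu0 mu1 H : Prop :=
  admissible mu0 mu1 H /\
  forall H' : borel_fmeasure R (X * X)%type, admissible mu0 mu1 H' ->
    LET l mu0 mu1 H <= LET l mu0 mu1 H'.

End LET.

Section euclidean.
Context (R : realType).

Definition euclidean_dist d (u v : 'rV[R]_d) : R :=
  Num.sqrt (\sum_(i < d) (u 0 i - v 0 i) ^+ 2).

(* The d-dimensional Lebesgue measure of Borel sets, as the d-fold product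
   of the one-dimensional one, computed by integrating over sections. *)
Fixpoint lebesgue_rV d : set (borel 'rV[R]_d) -> \bar R :=
  if d is n.+1 then fun A =>
    (\int[lebesgue_measure]_x
       lebesgue_rV [set v : 'rV[R]_n | A (row_mx (const_mx x : 'rV_1) v)])%E
  else fun A => (\1_A (0 : 'rV[R]_0))%:E.

End euclidean.

(* The measure of a set under the completion of [mu] (the restriction of its
   outer measure to the completed sigma-algebra). *)
Notation completed mu := (@completed_measure_extension _ _ _ mu).

(* Main.v *)
(* Write s_i for the density of the i-th marginal of H with respect to mu_i.
   Decreasing H on a rectangle {s_0 >= a} x {s_1 >= b} with a b > 1 to t H,
   for t < 1 with t^2 a b > 1, would strictly lower LET: the cost term does
   not increase, and by convexity of the entropy F with F' = ln, the entropies
   drop by at least (1 - t) ln (t^2 a b) times the H-mass of the rectangle.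
   Hence s_0(x) s_1(y) <= 1 for H-a.e. (x, y), and
     H(B_0 x B_1) <= int_{B_0 x B_1} (t / s_0(x) + 1 / (t s_1(y))) / 2 dH
                  <= (t mu_0(B_0) + mu_1(B_1) / t) / 2;
   optimizing in t > 0 gives H(B_0 x B_1) <= sqrt (mu_0(B_0) mu_1(B_1)).
   Finiteness of the cost makes l d(x, y) < pi / 2 H-a.e., so that mu_0, mu_1
   may be replaced by the reduced couple, and B_1 by any measurable set
   containing the thickening of B_0.  Measures of non-Borel sets are infima
   over Borel supersets. *)
Require Import Defs.
From HB Require Import structures.
From mathcomp Require Import all_boot all_order all_algebra.
From mathcomp Require Import all_classical all_reals all_analysis.
From mathcomp Require Import measurable_realfun.
From mathcomp Require Import ring lra.
Set Implicit Arguments.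
Unset Strict Implicit.
Unset Printing Implicit Defensive.
Import Order.TTheory GRing.Theory Num.Theory.
Import numFieldNormedType.Exports.
Local Open Scope classical_set_scope.
Local Open Scope ring_scope.
Local Open Scope ereal_scope.

(** * Elementary inequalities for the logarithm, the entropy and square roots *)

Section real_inequalities.
Context (R : realType).
Local Open Scope ring_scope.
Implicit Types (r s t : R).

Lemma ln_le_subr1 r : 0 < r -> ln r <= r - 1.
Proof.
move=> r0; have -> : r = 1 + (r - 1) by ring.
rewrite (le_trans (le_ln1Dx _))//; lra.
Qed.

(** For [r > 0] this is [ln (1 / r) <= 1 / r - 1] multiplied by [r]; for [r <= 0] the convention
    [ln r = 0] leaves [1 - r]. *)
Lemma entropy_ge0 r : 0 <= entropy r.
Proof.
rewrite /entropy; have [r0|r0] := leP r 0.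
  by rewrite ln0//; lra.
have := @ln_le_subr1 r^-1; rewrite invr_gt0 lnV// => /(_ r0) h.
have := mulfV (lt0r_neq0 r0) => rV.
nra.
Qed.

Lemma entropy0 : @entropy R 0 = 1.
Proof. by rewrite /entropy mul0r; lra. Qed.

(* Convexity: F s - F t >= F' t (s - t) with F' = ln. *)
Lemma entropy_tangent c s t : 0 < c -> t <= s -> c <= t \/ t = s ->
  entropy t + ln c * (s - t) <= entropy s.
Proof.
move=> c0 ts [ct|->]; last by rewrite subrr mulr0 addr0.
have t0 : 0 < t by lra.
have s0 : 0 < s by lra.
have lct : ln c <= ln t by rewrite ler_ln.
have : ln (t / s) <= t / s - 1 by rewrite ln_le_subr1// divr_gt0.
rewrite ln_div// => h.
(* After expansion this is the tangent inequality with slope [ln t]; as [s - t >= 0], the slope may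
   be lowered to [ln c]. *)
have : s * (ln t - ln s) <= t - s.
  have -> : t - s = s * (t / s - 1) by field; rewrite gt_eqF.
  by rewrite ler_pM2l.
rewrite /entropy => h1.
have h2 : ln c * (s - t) <= ln t * (s - t) by rewrite ler_wpM2r// subr_ge0.
lra.
Qed.

(** The choice [t = h / m0] gives [h^2 <= (h^2 + m0 m1) / 2], without forming the optimal
    [sqrt (m1 / m0)]. If [m0 = 0], a positive [h] is excluded by [t = m1 / h], which would give
    [h <= h / 2], or by [t = 1] when [m1 = 0] too. *)
Lemma le_sqrt_of_scaled_mean h m0 m1 : 0 <= h -> 0 <= m0 -> 0 <= m1 ->
  (forall t, 0 < t -> h <= (t * m0 + t^-1 * m1) / 2) ->
  h <= Num.sqrt (m0 * m1).
Proof.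
move=> h0 m00 m10 H.
rewrite -[leLHS]ger0_norm// -sqrtr_sqr ler_sqrt ?mulr_ge0//.
move: h0; rewrite le_eqVlt => /predU1P[<-|h0].
  by rewrite expr0n/= mulr_ge0.
move: m00; rewrite le_eqVlt => /predU1P[m00|m00].
  move: m10; rewrite le_eqVlt => /predU1P[m10|m10].
    by have := H 1 ltr01; rewrite -m00 -m10 !mulr0 add0r mul0r leNgt h0.
  have := H (m1 / h) (divr_gt0 m10 h0).
  rewrite -m00 mulr0 add0r invf_div divfK ?gt_eqF//; lra.
have := H (h / m0) (divr_gt0 h0 m00).
rewrite divfK ?gt_eqF// invf_div => h1.
have : h * h <= h * ((h + m0 / h * m1) / 2) by rewrite ler_pM2l.
have -> : h * ((h + m0 / h * m1) / 2) = (h ^+ 2 + m0 * m1) / 2.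
  by field; rewrite gt_eqF.
rewrite expr2; lra.
Qed.

End real_inequalities.

(** * Signs of integrands, outer measures and null sets *)

Section integral_lemmas.
Context d (T : measurableType d) (R : realType).
Implicit Types mu : {measure set T -> \bar R}.

(** On the part of [D] where [f < 0], the integral of [|f|] is the opposite of a nonnegative
    integral, so it vanishes and that part is null. *)
Lemma ae_ge0_of_integral mu (D : set T) (f : T -> \bar R) : measurable D ->
  measurable_fun setT f ->
  (forall A, measurable A -> A `<=` D -> 0 <= \int[mu]_(x in A) f x) ->
  \forall x \ae mu, D x -> 0 <= f x.
Proof.
move=> mD mf If.
pose N := D `&` [set x | f x < 0].
have mN : measurable N.
  apply: measurableI => //; rewrite -[X in measurable X]setTI.
  exact: emeasurable_fun_infty_o.
have mfN : measurable_fun N f by exact: measurable_funTS.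
have absN : \int[mu]_(x in N) `|f x| = 0.
  apply/eqP; rewrite eq_le integral_ge0// andbT.
  under eq_integral => x /[!inE] -[_ /= fx0] do rewrite lte0_abs//.
  have := If N mN (@subIsetl _ _ _).
  under eq_integral do rewrite -[f _]oppeK.
  rewrite (@integral_ge0N _ _ _ _ _ (fun x => - f x)) ?oppe_ge0//.
  by move=> x [_ /= fx0]; rewrite oppe_ge0 ltW.
move/(ae_eq_integral_abs mu mN mfN): absN.
apply: filterS => x fN Dx; rewrite leNgt; apply/negP => fx.
by have := fN (conj Dx fx) => fx0; rewrite fx0 ltxx in fx.
Qed.

(** The completed measure is the infimum of sums over countable measurable covers of [S]. The union
    of a cover is a measurable superset, to which the assumption applies; squared and divided by
    [m], the bound passes to the infimum. *)
Lemma le_sqrt_outer (mu : {finite_measure set T -> \bar R})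
    (h m : \bar R) (S : set T) :
  0 <= h -> h \is a fin_num -> 0 <= m -> m \is a fin_num ->
  (forall B, measurable B -> S `<=` B -> h <= sqrte (m * mu B)) ->
  h <= sqrte (m * completed mu S).
Proof.
move=> h0 hf m0 mf H.
have oge0 : 0 <= completed mu S by exact: mu_ext_ge0.
have sq B : 0 <= mu B -> (h <= sqrte (m * mu B)) = (h ^+ 2 <= m * mu B).
  move=> B0; rewrite -[in LHS](gee0_abs h0) -sqrte_sqr lee_sqrt//.
  by rewrite mule_ge0.
have {}H B : measurable B -> S `<=` B -> h ^+ 2 <= m * mu B.
  by move=> mB SB; rewrite -sq//; exact: H.
rewrite -(gee0_abs h0) -sqrte_sqr lee_sqrt ?mule_ge0//.
have [m0'|m_gt0] := eqVneq m 0.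
  by have := H setT measurableT (@subsetT _ S); rewrite m0' !mul0e.
have mpos : 0 < m by rewrite lt0e m_gt0.
rewrite -(fineK mf) in H mpos *.
have r0 : (0 < fine m)%R by rewrite -lte_fin.
rewrite -lee_pdivrMl//; apply: le_ereal_inf_tmp => _ [F [mF SF] <-].
apply: le_trans (_ : mu (\bigcup_k F k) <= _).
  by rewrite lee_pdivrMl//; apply: H => //; exact: bigcup_measurable.
by apply: measure_sigma_subadditive => //; exact: bigcup_measurable.
Qed.

End integral_lemmas.

Lemma dominated_le d (T : measurableType d) (R : realType)
    (mu nu nu' : {measure set T -> \bar R}) :
  nu `<< mu -> (forall A, measurable A -> nu' A <= nu A) -> nu' `<< mu.
Proof.
move=> /null_content_dominatesP numu nu'nu.
apply/null_content_dominatesP => A mA A0; apply/eqP.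
by rewrite eq_le measure_ge0 andbT (le_trans (nu'nu _ mA))// numu.
Qed.

Lemma ae_forall_countType d (T : measurableType d) (R : realType)
    (mu : {measure set T -> \bar R}) (I : countType) (P : I -> T -> Prop) :
  (forall i, {ae mu, forall x, P i x}) -> {ae mu, forall x, forall i, P i x}.
Proof.
move=> aeP.
have /ae_foralln : forall n, {ae mu, forall x,
    if @unpickle I n is Some i then P i x else True}.
  by move=> n; case: unpickle => [i|]; [exact: aeP|exact: aeW].
by apply: filterS => x Px i; have := Px (pickle i); rewrite pickleK.
Qed.

(** * Radon-Nikodym densities and the entropy functional *)

Section density.
Local Open Scope charge_scope.
Context (R : realType) (X : completeMetricType R).
Implicit Types mu nu : borel_fmeasure R X.

Lemma EFin_density nu mu : nu `<< mu -> (fun x => (density nu mu x)%:E) =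
  ('d (charge_of_finite_measure nu) '/d mu) :> (borel X -> \bar R).
Proof.
by move=> numu; apply/funext => x; rewrite fineK// Radon_Nikodym_fin_num.
Qed.

Lemma integrable_density nu mu : nu `<< mu ->
  mu.-integrable setT (fun x => (density nu mu x)%:E).
Proof. by move=> numu; rewrite EFin_density//; exact: Radon_Nikodym_integrable. Qed.

Lemma measurable_density nu mu : nu `<< mu ->
  measurable_fun setT (density nu mu : borel X -> R).
Proof.
by move=> /integrable_density/measurable_int/measurable_EFinP.
Qed.

Lemma integral_density nu mu A : nu `<< mu -> measurable A ->
  \int[mu]_(x in A) (density nu mu x)%:E = nu A.
Proof.
by move=> numu mA; rewrite EFin_density// -Radon_Nikodym_integral.
Qed.

Lemma density_ge0 nu mu : nu `<< mu ->
  {ae mu, forall x : borel X, (0 <= density nu mu x)%R}.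
Proof.
move=> numu.
apply: filterS (ae_ge0_of_integral measurableT
  (measurable_int _ (integrable_density numu)) _) => [x /(_ I)|A mA _].
  by rewrite lee_fin.
by rewrite integral_density.
Qed.

(** The sign criterion [ae_ge0_of_integral] is applied to the difference of the densities. The set
    [D] makes it usable for measures that are compared only off some set. *)
Lemma density_le nu nu' mu (c : R) D : nu `<< mu -> nu' `<< mu ->
  measurable D ->
  (forall A, measurable A -> A `<=` D -> c%:E * nu A <= nu' A) ->
  {ae mu, forall x : borel X, D x -> (c * density nu mu x <= density nu' mu x)%R}.
Proof.
move=> numu nu'mu mD le_nu.
pose f (x : borel X) := (density nu' mu x)%:E - c%:E * (density nu mu x)%:E.
have mf : measurable_fun setT f.
  apply: emeasurable_funB; first exact/measurable_int/integrable_density.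
  by apply: measurable_funeM; exact/measurable_int/integrable_density.
apply: filterS (ae_ge0_of_integral mD mf _) => [x h /h|A mA AD].
- by rewrite /f -EFinM -EFinB lee_fin subr_ge0.
- rewrite /f integralB//; last 2 first.
  + exact/(integrableS measurableT)/integrable_density.
  + exact/integrableZl/(integrableS measurableT)/integrable_density.
  rewrite integralZl//; last exact/(integrableS measurableT)/integrable_density.
  rewrite !integral_density// sube_ge0 ?le_nu//.
  by rewrite fin_numM ?fin_num_measure// orbT.
Qed.

Lemma density_gt0 (nu mu : borel_fmeasure R X) : nu `<< mu ->
  {ae nu, forall x : borel X, (0 < density nu mu x)%R}.
Proof.
move=> numu; pose N := [set x : borel X | (density nu mu x <= 0)%R].
have mN : measurable N.
  rewrite -[X in measurable X]setTI.
  have := measurable_density numu measurableT.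
  by move/(_ `]-oo, 0%R]%classic (measurable_itv _)); rewrite set_itvE.
exists N; split => //; last by move=> x /= /negP; rewrite -leNgt.
apply/eqP; rewrite eq_le measure_ge0 andbT -(integral_density numu mN).
rewrite -(integral0 mu N); apply: le_integral => //.
- by apply: (integrableS measurableT) => //; exact: integrable_density.
- exact: integrable0.
- by move=> x /[!inE] Nx; rewrite lee_fin.
Qed.

Definition entropy_integral nu mu : \bar R :=
  \int[mu]_x (entropy (density nu mu x))%:E.

Lemma measurable_entropy : measurable_fun setT (@entropy R).
Proof.
apply: measurable_funD => //; apply: measurable_funB => //.
by apply: measurable_funM => //; exact: measurable_ln.
Qed.

Lemma measurable_entropy_density nu mu : nu `<< mu ->
  measurable_fun setT (fun x : borel X => (entropy (density nu mu x))%:E).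
Proof.
move=> numu; apply/measurable_EFinP.
exact: (measurableT_comp measurable_entropy (measurable_density numu)).
Qed.

Lemma entropy_integral_ge0 nu mu : 0 <= entropy_integral nu mu.
Proof. by apply: integral_ge0 => x _; rewrite lee_fin entropy_ge0. Qed.

(** The density vanishes almost everywhere and [entropy 0 = 1]. This evaluates the entropy terms at
    the zero plan. *)
Lemma entropy_integral_zero nu mu : nu setT = 0 -> nu `<< mu ->
  entropy_integral nu mu = mu setT.
Proof.
move=> nu0 numu.
have {}nu0 A : measurable A -> nu A = 0.
  move=> mA; apply/eqP; rewrite eq_le measure_ge0 andbT -nu0.
  by apply: le_measure; rewrite ?inE.
have nu_le : {ae mu, forall x : borel X, (density nu mu x <= 0)%R}.
  apply: filterS (@ae_ge0_of_integral _ _ _ mu setT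
      (fun x => - (density nu mu x)%:E) measurableT _ _) => [x /(_ I)||A mA _].
  - by rewrite -EFinN lee_fin oppr_ge0.
  - exact/measurableT_comp/measurable_int/integrable_density.
  - rewrite integralN ?integral_density ?nu0 ?oppe0//.
    exact/integrable_add_def/(integrableS measurableT)/integrable_density.
rewrite /entropy_integral -[RHS]mul1e -integral_cst//.
apply: ae_eq_integral => //; first exact: measurable_entropy_density.
apply: filterS (filterI (density_ge0 numu) nu_le) => x [x0 x1] _ /=.
have -> : density nu mu x = 0%R by apply/eqP; rewrite eq_le x0 x1.
by rewrite entropy0.
Qed.

(** Integrates [entropy_tangent] with slope [ln c]: on [A] the new density is at least [c], and off
    [A] the two densities coincide almost everywhere, which is its second alternative. The same
    bound makes the new entropy finite. *)
Lemma entropy_integral_decrease nu nu' mu (c : R) (A : set (borel X)) :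
  nu `<< mu -> nu' `<< mu -> (0 < c)%R -> measurable A ->
  (forall B, measurable B -> nu' B <= nu B) ->
  (forall B, measurable B -> B `<=` ~` A -> nu' B = nu B) ->
  {ae mu, forall x : borel X, A x -> (c <= density nu' mu x)%R} ->
  entropy_integral nu mu < +oo ->
  entropy_integral nu' mu \is a fin_num /\
  entropy_integral nu' mu + (ln c)%:E * (nu setT - nu' setT)
    <= entropy_integral nu mu.
Proof.
move=> numu nu'mu c0 mA nu'nu nu'A nu'c fin_nu.
pose s := density nu mu; pose t := density nu' mu.
have ts : {ae mu, forall x : borel X, (t x <= s x)%R}.
  apply: filterS (density_le nu'mu numu measurableT (c := 1) _) => [x /(_ I)|B mB _].
    by rewrite mul1r.
  by rewrite mul1e nu'nu.
have st : {ae mu, forall x : borel X, (~` A) x -> (s x <= t x)%R}.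
  apply: filterS (density_le numu nu'mu (measurableC mA) (c := 1) _) =>
      [x|B mB BA].
    by rewrite mul1r.
  by rewrite mul1e nu'A.
have {st ts nu'c} tangent : {ae mu, forall x : borel X,
    (entropy (t x) + ln c * (s x - t x) <= entropy (s x))%R}.
  apply: filterS (filterI ts (filterI st nu'c)) => x [tsx [stx ctx]].
  apply: entropy_tangent => //; have [Ax|nAx] := pselect (A x).
    by left; exact: ctx.
  by right; apply/eqP; rewrite eq_le tsx stx.
have is_ := integrable_density numu; have it := integrable_density nu'mu.
have iFs : mu.-integrable setT (fun x => (entropy (s x))%:E).
  apply/integrableP; split; first exact: measurable_entropy_density.
  by under eq_integral do rewrite gee0_abs ?lee_fin ?entropy_ge0//.
pose g (x : borel X) := (entropy (s x))%:E - (ln c)%:E * ((s x)%:E - (t x)%:E).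
have ig : mu.-integrable setT g.
  by apply: integrableB => //; apply: integrableZl => //; exact: integrableB.
have Ftg : {ae mu, forall x : borel X, setT x -> (entropy (t x))%:E <= g x}.
  apply: filterS tangent => x h _.
  rewrite [leRHS](_ : _ = (entropy (s x) - ln c * (s x - t x))%:E)//.
  by rewrite lee_fin lerBrDr.
have Ig : \int[mu]_x g x =
    entropy_integral nu mu - (ln c)%:E * (nu setT - nu' setT).
  rewrite integralB//; last by apply: integrableZl => //; exact: integrableB.
  rewrite integralZl//; last exact: integrableB.
  by rewrite integralB// !integral_density.
have : entropy_integral nu' mu <= \int[mu]_x g x.
  (* The upper bound [g] is nonnegative only almost everywhere; passing to its absolute value allows
     a comparison of integrals of nonnegative functions. *)
  have -> : \int[mu]_x g x = \int[mu]_x `|g x|.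
    apply: ae_eq_integral => //; first exact: measurable_int ig.
      exact/measurableT_comp/measurable_int/ig.
    apply: filterS Ftg => x h _; rewrite gee0_abs//.
    by rewrite (le_trans _ (h I))// lee_fin entropy_ge0.
  apply: ae_ge0_le_integral => //.
  - by move=> x _; rewrite lee_fin entropy_ge0.
  - exact: measurable_entropy_density.
  - exact/measurableT_comp/measurable_int/ig.
  - by apply: filterS Ftg => x h /h {}h; rewrite (le_trans h)// lee_abs.
rewrite Ig => le_g.
have fin0 : (ln c)%:E * (nu setT - nu' setT) \is a fin_num.
  by rewrite fin_numM// fin_numB !fin_num_measure.
have finF : entropy_integral nu mu \is a fin_num.
  by rewrite ge0_fin_numE// entropy_integral_ge0.
split; last by rewrite -leeBrDr.
rewrite ge0_fin_numE ?entropy_integral_ge0// (le_lt_trans le_g)//.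
by rewrite ltey_eq fin_numB finF fin0.
Qed.

End density.

(** * Scaling a measure down on a measurable set *)

Section damping.
Context (R : realType) d (T : measurableType d).
Variables (t : {nonneg R}) (m : {finite_measure set T -> \bar R}).
Variables (E : set T) (mE : measurable E).

(** Competitors of the minimizer have this form: [0 < t < 1] on a rectangle for the variation, and
    [t = 0] on the whole space for the zero plan. *)
Definition damp : set T -> \bar R :=
  measure_add (mscale t (mrestr m mE)) (mrestr m (measurableC mE)).

HB.instance Definition _ := Measure.on damp.

Lemma dampE A : damp A = t%:num%:E * m (A `&` E) + m (A `\` E).
Proof. by rewrite /damp measure_addE. Qed.

Let damp_fin : fin_num_fun damp.
Proof.
move=> A mA; rewrite dampE fin_numD; apply/andP; split.
  by apply: fin_numM => //; exact/fin_num_measure/measurableI.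
exact/fin_num_measure/measurableD.
Qed.

HB.instance Definition _ := Measure_isFinite.Build _ _ _ damp damp_fin.

Lemma damp_split A : measurable A -> m A = m (A `&` E) + m (A `\` E).
Proof. by move=> mA; rewrite addeC -measureDI. Qed.

Lemma damp_le A : (t%:num <= 1)%R -> measurable A -> damp A <= m A.
Proof.
move=> t1 mA; rewrite dampE (damp_split mA) leeD2r// gee_pMl ?lee_fin//.
Qed.

Lemma damp_ge A : (t%:num <= 1)%R -> measurable A -> t%:num%:E * m A <= damp A.
Proof.
move=> t1 mA; rewrite dampE (damp_split mA) ge0_muleDr// leeD2l//.
by rewrite gee_pMl ?lee_fin//.
Qed.

Lemma damp_off A : A `&` E = set0 -> damp A = m A.
Proof. by move=> AE; rewrite dampE AE measure0 mule0 add0e setDidl. Qed.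

(** Both marginals of a damped plan lose this same total mass, so it is the factor in both entropy
    estimates. *)
Lemma damp_loss : m setT - damp setT = (1 - t%:num)%:E * m E.
Proof.
rewrite dampE (damp_split measurableT) !setTI.
have fE : m E \is a fin_num by exact: fin_num_measure.
have fCE : m (~` E) \is a fin_num by exact/fin_num_measure/measurableC.
rewrite setTD; case: (m E) fE => // e _; case: (m (~` E)) fCE => // c _.
rewrite [LHS](_ : _ = (e + c - (t%:num * e + c))%:E)// -EFinM.
by congr EFin; ring.
Qed.

End damping.

(** * Borel sets of the product, marginals and the distance function *)

Section product_space.
Context (R : realType) (X : completeMetricType R).
Implicit Types (H : borel_fmeasure R (X * X)%type) (A B : set (borel X)).

Lemma measurable_fst_borel :
  measurable_fun setT (fst : borel (X * X)%type -> borel X).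
Proof.
by apply: (@continuous_borel_measurable (X * X)%type X fst) => x; exact: cvg_fst.
Qed.

Lemma measurable_snd_borel :
  measurable_fun setT (snd : borel (X * X)%type -> borel X).
Proof.
by apply: (@continuous_borel_measurable (X * X)%type X snd) => x; exact: cvg_snd.
Qed.

Lemma measurable_fst_preimage A : measurable A ->
  measurable (fst @^-1` A : set (borel (X * X)%type)).
Proof. by move=> mA; rewrite -[X in measurable X]setTI; exact: measurable_fst_borel. Qed.

Lemma measurable_snd_preimage A : measurable A ->
  measurable (snd @^-1` A : set (borel (X * X)%type)).
Proof. by move=> mA; rewrite -[X in measurable X]setTI; exact: measurable_snd_borel. Qed.

Lemma measurable_setX_borel A B : measurable A -> measurable B ->
  measurable (A `*` B : set (borel (X * X)%type)).
Proof.
move=> mA mB; rewrite (_ : A `*` B = fst @^-1` A `&` snd @^-1` B)//.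
apply: measurableI; [exact: measurable_fst_preimage|].
exact: measurable_snd_preimage.
Qed.

Lemma ae_marg0 H (P : borel X -> Prop) : {ae marg0 H, forall x, P x} ->
  {ae H, forall p : borel (X * X)%type, P p.1}.
Proof.
move=> [N [mN N0 PN]]; exists (fst @^-1` N); split => //.
- exact: measurable_fst_preimage.
- by move=> p /= /PN.
Qed.

Lemma ae_marg1 H (P : borel X -> Prop) : {ae marg1 H, forall x, P x} ->
  {ae H, forall p : borel (X * X)%type, P p.2}.
Proof.
move=> [N [mN N0 PN]]; exists (snd @^-1` N); split => //.
- exact: measurable_snd_preimage.
- by move=> p /= /PN.
Qed.

Lemma ae_dominated (mu nu : borel_fmeasure R X) (P : borel X -> Prop) :
  nu `<< mu -> {ae mu, forall x, P x} -> {ae nu, forall x, P x}.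
Proof.
move=> /null_content_dominatesP numu [N [mN N0 PN]]; exists N; split => //.
exact: numu.
Qed.

Lemma continuous_mdist :
  continuous (fun p : X * X => mdist p.1 p.2 : R).
Proof.
move=> [x y]; apply/cvgrPdist_lt => e e0.
have e20 : (0 < e / 2)%R by rewrite divr_gt0.
near=> p.
have : ball x (e / 2)%R p.1.
  by near: p; exists (ball x (e / 2), setT) => //=;
    [split; [exact: nbhsx_ballx|exact: filterT]|move=> ? []].
have : ball y (e / 2)%R p.2.
  by near: p; exists (setT, ball y (e / 2)) => //=;
    [split; [exact: filterT|exact: nbhsx_ballx]|move=> ? []].
rewrite !ballEmdist /= => yp xp.
have h1 := metric_triangle x p.1 y; have h2 := metric_triangle p.1 p.2 y.
have h3 := metric_triangle p.1 x p.2; have h4 := metric_triangle x y p.2.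
rewrite (metric_sym p.2 y) in h2.
rewrite (metric_sym p.1 x) in h3.
rewrite ltr_norml; lra.
Unshelve. all: by end_near. Qed.

(** The sigma-algebra is the one generated by the open sets of the product, so continuity of the
    distance suffices. *)
Lemma measurable_mdist :
  measurable_fun setT (fun p : borel (X * X)%type => mdist p.1 p.2 : R).
Proof.
apply: (measurability _ (RGenOpens.measurableE R)) => //.
move=> _ [_ [a [b ->]] <-].
rewrite setTI; apply: sub_sigma_algebra.
by move/continuousP : continuous_mdist; apply; exact: interval_open.
Qed.

End product_space.

(** * Sign and measurability of the transport cost *)

Section cost.
Context (R : realType) (X : completeMetricType R).
Implicit Types (H : borel_fmeasure R (X * X)%type) (l : R).

Lemma cost_ge0 l r : 0 <= cost l r.
Proof.
rewrite /cost; case: ifPn => // _.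
(* Where the cosine is not positive, [ln] is 0 by convention, so the logarithm is at most 0 for
   every argument. *)
by rewrite lee_fin mulr_le0 ?oppr_le0// ln_le0// cos_le1.
Qed.

Lemma measurable_cost l : measurable_fun setT (cost l).
Proof.
apply: measurable_fun_ifT => //.
- by apply: measurable_fun_ltr => //; exact: mulrl_measurable.
- apply/measurable_EFinP; apply: measurable_funM => //.
  apply: (measurableT_comp (@measurable_ln R)).
  apply: measurableT_comp; last exact: mulrl_measurable.
  by apply: continuous_measurable_fun; exact: continuous_cos.
Qed.

Lemma measurable_cost_mdist l :
  measurable_fun setT (fun p : borel (X * X)%type => cost l (mdist p.1 p.2)).
Proof. exact: (measurableT_comp (measurable_cost l) (@measurable_mdist R X)). Qed.

End cost.

(** * Variations of a minimizer *)

Section minimizer.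
Context (R : realType) (X : completeMetricType R) (l : R).
Variables (mu0 mu1 : borel_fmeasure R X) (H : borel_fmeasure R (X * X)%type).
Hypothesis Hmin : LET_minimizer l mu0 mu1 H.

Let Hmu0 : marg0 H `<< mu0. Proof. by have [[]] := Hmin. Qed.
Let Hmu1 : marg1 H `<< mu1. Proof. by have [[]] := Hmin. Qed.

(** The zero plan is admissible, with value [mu0 setT + mu1 setT]. *)
Lemma LET_finite : LET l mu0 mu1 H < +oo.
Proof.
pose H0 : borel_fmeasure R (X * X)%type := damp (NngNum (lexx 0%R)) H measurableT.
have H00 A : H0 A = 0.
  by rewrite [LHS]dampE mul0e add0e setDT measure0.
have adm : admissible mu0 mu1 H0.
  by split; apply/null_content_dominatesP => A mA _; exact: H00.
apply: le_lt_trans (Hmin.2 _ adm) _.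
rewrite /LET -/(entropy_integral (marg0 H0) mu0).
rewrite -/(entropy_integral (marg1 H0) mu1).
rewrite (entropy_integral_zero _ adm.1); last exact: H00.
rewrite (entropy_integral_zero _ adm.2); last exact: H00.
rewrite (ge0_negligible_integral measurableT measurableT)//; last 3 first.
- exact: measurable_cost_mdist.
- by move=> p _; exact: cost_ge0.
- exact: H00.
rewrite setDv integral_set0 adde0.
by rewrite ltey_eq fin_numD !fin_num_measure.
Qed.

Let I0 := entropy_integral (marg0 H) mu0.
Let I1 := entropy_integral (marg1 H) mu1.
Let K := \int[H]_p cost l (mdist p.1 p.2).

Lemma LET_finite_parts :
  [/\ I0 < +oo, I1 < +oo & K < +oo].
Proof.
have := LET_finite; rewrite (_ : LET l mu0 mu1 H = I0 + I1 + K)//.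
have : 0 <= I0 := entropy_integral_ge0 _ _.
have : 0 <= I1 := entropy_integral_ge0 _ _.
have : 0 <= K by apply: integral_ge0 => p _; exact: cost_ge0.
by case: K => [k||]; case: I1 => [i1||]; case: I0 => [i0||] //=; rewrite ?ltry.
Qed.

Lemma null_above (a b : R) (A0 A1 : set (borel X)) :
  (0 < a)%R -> (0 < b)%R -> (1 < a * b)%R ->
  measurable A0 -> measurable A1 ->
  (forall x, A0 x -> a <= density (marg0 H) mu0 x)%R ->
  (forall x, A1 x -> b <= density (marg1 H) mu1 x)%R ->
  H (A0 `*` A1) = 0.
Proof.
move=> a0 b0 ab1 mA0 mA1 A0a A1b.
have mE := measurable_setX_borel mA0 mA1.
set E := A0 `*` A1 in mE *.
have [t [t0 t1 tab]] : exists t : R, [/\ 0 < t, t < 1 & 1 < (t * a) * (t * b)]%R.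
  (* The witness is [t = (a b)^(-1/4)], for which [t^2 a b = sqrt (a b) > 1]. *)
  pose r := Num.sqrt (a * b); pose q := Num.sqrt r.
  have r1 : (1 < r)%R by rewrite -sqrtr1 ltr_sqrt// (lt_trans ltr01).
  have q1 : (1 < q)%R by rewrite -sqrtr1 ltr_sqrt// (lt_trans ltr01).
  have q0 : (0 < q)%R by rewrite (lt_trans ltr01).
  have qr : (q ^+ 2 = r)%R by rewrite sqr_sqrtr// (le_trans ler01)// ltW.
  have rab : (r ^+ 2 = a * b)%R by rewrite sqr_sqrtr// mulr_ge0// ltW.
  exists q^-1%R; split; [by rewrite invr_gt0|by rewrite invf_lt1|].
  rewrite mulrACA -rab -qr -expr2 -exprMn.
  rewrite (_ : q^-1 * q ^+ 2 = q)%R; last by field; rewrite gt_eqF.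
  by rewrite qr.
pose tn : {nonneg R} := NngNum (ltW t0).
pose H' : borel_fmeasure R (X * X)%type := damp tn H mE.
have H'le A : measurable A -> H' A <= H A.
  by move=> mA; apply: damp_le => //=; exact: ltW.
have H'ge A : measurable A -> t%:E * H A <= H' A.
  by move=> mA; apply: (@damp_ge _ _ _ tn) => //=; exact: ltW.
have dom0 : marg0 H' `<< mu0.
  apply: dominated_le Hmu0 _ => A mA; apply: H'le.
  exact: measurable_fst_preimage.
have dom1 : marg1 H' `<< mu1.
  apply: dominated_le Hmu1 _ => A mA; apply: H'le.
  exact: measurable_snd_preimage.
have [I0y I1y Ky] := LET_finite_parts.
have lossE : H setT - H' setT = (1 - t)%:E * H E by exact: damp_loss.
have [f0] : entropy_integral (marg0 H') mu0 \is a fin_num /\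
    entropy_integral (marg0 H') mu0 + (ln (t * a))%:E * ((1 - t)%:E * H E)
    <= I0.
  rewrite -lossE; apply: (@entropy_integral_decrease _ _
    (marg0 H) (marg0 H') mu0 (t * a) A0) => //.
  - exact: mulr_gt0.
  - by move=> B mB; apply: H'le; exact: measurable_fst_preimage.
  (* A set disjoint from [A0] has a preimage disjoint from the rectangle, where damping changes
     nothing. *)
  - move=> B mB BA; apply: damp_off; apply/seteqP; split => // -[x y] [/= Bx [Ax _]].
    exact: BA Bx Ax.
  - apply: filterS (density_le Hmu0 dom0 measurableT (c := t) _) => [x h Ax|B mB _].
      by rewrite (le_trans _ (h I))// ler_pM2l// A0a.
    by apply: H'ge; exact: measurable_fst_preimage.
have [f1] : entropy_integral (marg1 H') mu1 \is a fin_num /\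
    entropy_integral (marg1 H') mu1 + (ln (t * b))%:E * ((1 - t)%:E * H E)
    <= I1.
  rewrite -lossE; apply: (@entropy_integral_decrease _ _
    (marg1 H) (marg1 H') mu1 (t * b) A1) => //.
  - exact: mulr_gt0.
  - by move=> B mB; apply: H'le; exact: measurable_snd_preimage.
  - move=> B mB BA; apply: damp_off; apply/seteqP; split => // -[x y] [/= By [_ Ay]].
    exact: BA By Ay.
  - apply: filterS (density_le Hmu1 dom1 measurableT (c := t) _) => [x h Ax|B mB _].
      by rewrite (le_trans _ (h I))// ler_pM2l// A1b.
    by apply: H'ge; exact: measurable_snd_preimage.
have K'K : \int[H']_p cost l (mdist p.1 p.2) <= K.
  apply: ge0_le_measure_integral => //; last exact: measurable_cost_mdist.
  by move=> p; exact: cost_ge0.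
have K'0 : 0 <= \int[H']_p cost l (mdist p.1 p.2).
  by apply: integral_ge0 => p _; exact: cost_ge0.
have := Hmin.2 H' (conj dom0 dom1).
rewrite (_ : LET l mu0 mu1 H = I0 + I1 + K)//.
rewrite (_ : LET l mu0 mu1 H' = entropy_integral (marg0 H') mu0 +
  entropy_integral (marg1 H') mu1 + \int[H']_p cost l (mdist p.1 p.2))//.
have : 0 <= I0 := entropy_integral_ge0 _ _.
have : 0 <= I1 := entropy_integral_ge0 _ _.
have : H E \is a fin_num by exact: fin_num_measure.
have : 0 <= H E by exact: measure_ge0.
have lnab : (0 < ln (t * a) + ln (t * b))%R.
  by rewrite -lnM ?posrE ?mulr_gt0// ln_gt0.
move: I0y I1y Ky f0 f1 K'K K'0; move: (H E) I0 I1 K.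
move: (entropy_integral (marg0 H') mu0) (entropy_integral (marg1 H') mu1).
move: (\int[H']_p _).
case=> [k'||] [i0'||] [i1'||] [h||] [i0||] [i1||] [k||]//= _ _ _ _ _.
rewrite -!EFinM -!EFinD !lee_fin => kk k'0 h0 _ _ _ min d0 d1.
congr EFin; apply/eqP; rewrite eq_le h0 andbT.
(* Minimality, the cost comparison and the two entropy drops add up to
   [(ln (t a) + ln (t b)) (1 - t) h <= 0], where the factor of [h] is positive. *)
have := mulr_gt0 lnab (_ : 0 < 1 - t)%R; rewrite subr_gt0 => /(_ t1) pos.
rewrite -(pmulr_rle0 _ pos); nra.
Qed.

End minimizer.

(** * Supports in a separable space and reduced sets *)

Section support.
Context (R : realType) (X : completeMetricType R).
Local Open Scope ring_scope.

Lemma open_mball (x : X) (r : R) : open (ball x r).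
Proof.
rewrite openE => y; rewrite ballEmdist/= => xy.
have e0 : 0 < r - mdist x y by rewrite subr_gt0.
apply: filterS (nbhsx_ballx y _ e0) => z; rewrite ballEmdist/= => yz.
by rewrite (le_lt_trans (metric_triangle x y z))// -ltrBrDl.
Qed.

(** The complement of the support is covered by countably many null balls, centred in a countable
    dense set and of radii [1 / (n + 1)]. *)
Lemma ae_msupport (mu : borel_fmeasure R X) : separable_space X ->
  {ae mu, forall y : borel X, msupport mu y}.
Proof.
move=> [D cD dD].
have [s Ds] := @pcard_surjP X nat D setT cD.
pose B (k : nat * nat) := ball (s k.1) k.2.+1%:R^-1 : set X.
have : {ae mu, forall y : borel X, forall k, mu (B k) = 0%E -> ~ B k y}.
  apply: ae_forall_countType => k.
  have [B0|B0] := eqVneq (mu (B k)) 0%E; last first.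
    by apply: aeW => y B0'; rewrite B0' eqxx in B0.
  exists (B k); split => //.
    by apply: sub_sigma_algebra; exact: open_mball.
  by move=> y /= h; apply: contrapT => nB; apply: h.
apply: filterS => y noB U oU Uy.
rewrite lt0e measure_ge0 andbT; apply/eqP => U0.
have /nbhs_ballP[r /= r0 rU] : nbhs y U by exact: open_nbhs_nbhs.
have r20 : 0 < r / 2 by rewrite divr_gt0.
(* With this radius, a ball centred at a point [z] of [D] close to [y] contains [y] and stays inside
   [ball y r], hence is null. *)
have [n nr] : exists n, n.+1%:R^-1 < r / 2.
  by have [n _ h] := near_infty_natSinv_lt (PosNum r20); exists n; apply: (h n) => /=.
have n0 : 0 < n.+1%:R^-1 :> R by [].
have [z [yz Dz]] : (ball y n.+1%:R^-1 `&` D) !=set0.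
  by apply: dD; [exists y; exact: ballxx|exact: open_mball].
have [k _ kz] := Ds z Dz.
apply: (noB (k, n)); rewrite /B/= kz; last exact: ball_sym.
apply/eqP; rewrite eq_le measure_ge0 andbT -U0; apply: le_measure.
- by rewrite inE; apply: sub_sigma_algebra; exact: open_mball.
- by rewrite inE; apply: sub_sigma_algebra.
- apply: subset_trans rU => w zw.
  have := ball_triangle yz zw; apply: le_ball.
  by rewrite [leRHS]splitr; rewrite lerD// ltW.
Qed.

Lemma reduced_setP l (nu : borel_fmeasure R X) (x y : X) : 0 < l ->
  msupport nu y -> l * mdist x y < pi / 2 -> reduced_set l nu x.
Proof.
move=> l0 nuy lxy; rewrite /reduced_set/=.
apply: le_lt_trans (_ : (l%:E * (mdist x y)%:E < _)%E); last by rewrite -EFinM lte_fin.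
by rewrite lee_pmul2l// ?lte_fin//; apply: ereal_inf_lbound; exists y.
Qed.

End support.

(** * Almost-everywhere properties of a minimizer *)

Section minimizer_bound.
Context (R : realType) (X : completeMetricType R) (l : R).
Variables (mu0 mu1 : borel_fmeasure R X) (H : borel_fmeasure R (X * X)%type).
Hypothesis sepX : separable_space X.
Hypothesis l_gt0 : (0 < l)%R.
Hypothesis Hmin : LET_minimizer l mu0 mu1 H.

Let Hmu0 : marg0 H `<< mu0. Proof. by have [[]] := Hmin. Qed.
Let Hmu1 : marg1 H `<< mu1. Proof. by have [[]] := Hmin. Qed.
Let d0 : borel X -> R := density (marg0 H) mu0.
Let d1 : borel X -> R := density (marg1 H) mu1.

Lemma ae_mdist_lt :
  {ae H, forall p : borel (X * X)%type, (l * mdist p.1 p.2 < pi / 2)%R}.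
Proof.
have [_ _ Ky] := LET_finite_parts Hmin.
have iK : H.-integrable setT (fun p => cost l (mdist p.1 p.2)).
  apply/integrableP; split; first exact: measurable_cost_mdist.
  by under eq_integral do rewrite gee0_abs ?cost_ge0//.
apply: filterS (integrable_ae measurableT iK) => p /(_ I).
by rewrite /cost; case: ifPn.
Qed.

(** The marginals are dominated by [mu0] and [mu1], so almost every pair has its coordinates in the
    two supports; each coordinate then witnesses that the other is close to the opposite support. *)
Lemma ae_reduced : {ae H, forall p : borel (X * X)%type,
  reduced_set l mu1 p.1 /\ reduced_set l mu0 p.2}.
Proof.
have s0 := ae_marg0 (ae_dominated Hmu0 (ae_msupport mu0 sepX)).
have s1 := ae_marg1 (ae_dominated Hmu1 (ae_msupport mu1 sepX)).
apply: filterS (filterI ae_mdist_lt (filterI s0 s1)) => -[x y] [/= xy [sx sy]].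
split; first exact: reduced_setP xy.
by apply: reduced_setP sx _ => //; rewrite metric_sym.
Qed.

(** Pairs with product above 1 lie in countably many rectangles with rational thresholds [a], [b]
    such that [a b > 1], each null by [null_above]. *)
Lemma ae_density_mul_le1 : {ae H, forall p : borel (X * X)%type,
  (0 < d0 p.1 -> 0 < d1 p.2 -> d0 p.1 * d1 p.2 <= 1)%R}.
Proof.
have : {ae H, forall p : borel (X * X)%type, forall q : rat * rat,
    (0 < ratr q.1 :> R -> 0 < ratr q.2 :> R -> 1 < ratr q.1 * ratr q.2 :> R ->
    ~ (ratr q.1 <= d0 p.1 /\ ratr q.2 <= d1 p.2))%R}.
  apply: ae_forall_countType => -[a b]/=.
  have [a0|_] := boolP (0 < ratr a :> R)%R; last by apply: aeW.
  have [b0|_] := boolP (0 < ratr b :> R)%R; last by apply: aeW.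
  have [ab|_] := boolP (1 < ratr a * ratr b :> R)%R; last by apply: aeW.
  pose A0 := [set x | (ratr a <= d0 x)%R]; pose A1 := [set x | (ratr b <= d1 x)%R].
  have mA0 : measurable A0.
    rewrite -[X in measurable X]setTI.
    have := measurable_density Hmu0 measurableT.
    by move/(_ `[ratr a, +oo[%classic (measurable_itv _)); rewrite set_itvE.
  have mA1 : measurable A1.
    rewrite -[X in measurable X]setTI.
    have := measurable_density Hmu1 measurableT.
    by move/(_ `[ratr b, +oo[%classic (measurable_itv _)); rewrite set_itvE.
  exists (A0 `*` A1); split; first exact: measurable_setX_borel.
  - exact: (null_above Hmin a0 b0).
  - by move=> p /= h; apply: contrapT => np; apply: h.
apply: filterS => p np p0 p1; rewrite leNgt; apply/negP => gt1.
(* First [a] is chosen between [1 / d1 p.2] and [d0 p.1], then [b] between [1 / a] and [d1 p.2],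
   which forces [a b > 1]. *)
have : ((d1 p.2)^-1 < d0 p.1)%R by rewrite -[ltLHS]mul1r ltr_pdivrMr.
move=> /rat_in_itvoo[a]; rewrite in_itv/= => /andP[la a0].
have ap : (0 < ratr a :> R)%R by rewrite (lt_trans _ la)// invr_gt0.
have : ((ratr a)^-1 < d1 p.2)%R by rewrite invf_plt.
move=> /rat_in_itvoo[b]; rewrite in_itv/= => /andP[lb b0].
have bp : (0 < ratr b :> R)%R by rewrite (lt_trans _ lb)// invr_gt0.
apply: (np (a, b)) => //=; last by rewrite !ltW.
by rewrite -ltr_pdivrMl// mulr1.
Qed.

End minimizer_bound.

(** * The mass of rectangles under a minimizer *)

Section rectangle.
Context (R : realType) (X : completeMetricType R).

(** The maximum with 0 makes the reciprocal nonnegative everywhere, while the density is so only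
    almost everywhere. Writing it as [expR (- ln r)] reduces measurability to that of [expR] and
    [ln]. *)
Lemma measurable_density_inv (nu mu : borel_fmeasure R X) : nu `<< mu ->
  measurable_fun setT (fun x : borel X => (Num.max 0 (density nu mu x)^-1)%R).
Proof.
move=> numu; pose g (r : R) := (if 0 < r then expR (- ln r) else 0)%R.
have mg : measurable_fun setT g.
  apply: measurable_fun_ifT => //; first exact: measurable_fun_ltr.
  apply: (measurableT_comp (@measurable_expR R)).
  exact: measurableT_comp (@measurable_ln R).
rewrite (_ : (fun x => _) = g \o density nu mu).
  exact: (measurableT_comp mg (measurable_density numu)).
apply/funext => x; rewrite /g/=; case: ltP => d0.
  by rewrite max_r ?invr_ge0 ?ltW// -lnV// lnK ?posrE// invr_gt0.
by rewrite max_l// invr_le0.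
Qed.

(** Against [mu] the integrand becomes the truncated reciprocal times the density: almost everywhere
    1 where the density is positive and 0 elsewhere. *)
Lemma integral_density_inv (nu mu : borel_fmeasure R X) B : nu `<< mu ->
  measurable B ->
  \int[nu]_(x in B) (Num.max 0 (density nu mu x)^-1)%:E <= mu B.
Proof.
move=> numu mB; set f := fun x : borel X => (Num.max 0 (density nu mu x)^-1)%:E.
have f0 x : 0 <= f x by rewrite lee_fin le_max lexx.
have mf : measurable_fun setT f.
  by apply/measurable_EFinP; exact: measurable_density_inv.
change (\int[nu]_(x in B) f x <= mu B).
rewrite -(Radon_Nikodym_SigmaFinite.change_of_variables numu)//; last first.
  exact: measurable_funTS.
rewrite -[leRHS]mul1e -integral_cst//.
(* The change of variables uses its own version of the derivative, equal to the density almost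
   everywhere on [B]. *)
have RNE := ae_eq_Radon_Nikodym_SigmaFinite numu mB.
apply: ae_ge0_le_integral => //.
- by move=> x _; apply: mule_ge0 => //; exact: Radon_Nikodym_SigmaFinite.f_ge0.
- apply: emeasurable_funM; first exact: measurable_funTS.
  apply/measurable_funTS/measurable_int.
  exact: Radon_Nikodym_SigmaFinite.f_integrable.
- apply: filterS RNE => x h Bx; rewrite h//= -EFin_density// lee_fin.
  have [d_gt0|d_le0] := ltP 0%R (density nu mu x).
    by rewrite max_r ?invr_ge0 ?(ltW d_gt0)// mulVf// gt_eqF.
  by rewrite max_l ?invr_le0// mul0r.
Qed.

Variables (l : R) (mu0 mu1 : borel_fmeasure R X).
Variables (H : borel_fmeasure R (X * X)%type).
Hypothesis sepX : separable_space X.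
Hypothesis l_gt0 : (0 < l)%R.
Hypothesis Hmin : LET_minimizer l mu0 mu1 H.

Let Hmu0 : marg0 H `<< mu0. Proof. by have [[]] := Hmin. Qed.
Let Hmu1 : marg1 H `<< mu1. Proof. by have [[]] := Hmin. Qed.

Lemma rectangle_scaled_mean (t : R) (B0 B1 : set (borel X)) : (0 < t)%R ->
  measurable B0 -> measurable B1 ->
  H (B0 `*` B1) <= 2^-1%:E * (t%:E * mu0 B0 + t^-1%:E * mu1 B1).
Proof.
move=> t0 mB0 mB1.
pose f0 x : \bar R := (Num.max 0 (density (marg0 H) mu0 x)^-1)%:E.
pose f1 x : \bar R := (Num.max 0 (density (marg1 H) mu1 x)^-1)%:E.
have f00 x : 0 <= f0 x by rewrite lee_fin le_max lexx.
have f10 x : 0 <= f1 x by rewrite lee_fin le_max lexx.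
have mf0 : measurable_fun setT (f0 : borel X -> \bar R).
  by apply/measurable_EFinP; exact: measurable_density_inv.
have mf1 : measurable_fun setT (f1 : borel X -> \bar R).
  by apply/measurable_EFinP; exact: measurable_density_inv.
have mF0 : measurable_fun setT (fun p : borel (X * X)%type => f0 p.1).
  exact: (measurableT_comp mf0 (@measurable_fst_borel R X)).
have mF1 : measurable_fun setT (fun p : borel (X * X)%type => f1 p.2).
  exact: (measurableT_comp mf1 (@measurable_snd_borel R X)).
have mBB := measurable_setX_borel mB0 mB1.
(* The integrand depends on the first coordinate only: enlarging the rectangle to the cylinder over
   [B0] gives an integral against the first marginal. *)
have I0 : \int[H]_(p in B0 `*` B1) f0 p.1 <= mu0 B0.
  rewrite (le_trans _ (integral_density_inv Hmu0 mB0))//.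
  rewrite (ge0_integral_pushforward (@measurable_fst_borel R X))//; last 2 first.
  - exact: measurable_funTS mf0.
  - by move=> x _; exact: f00.
  apply: ge0_subset_integral => //.
  - exact: measurable_fst_preimage.
  - exact: measurable_funTS.
  - by move=> p [].
have I1 : \int[H]_(p in B0 `*` B1) f1 p.2 <= mu1 B1.
  rewrite (le_trans _ (integral_density_inv Hmu1 mB1))//.
  rewrite (ge0_integral_pushforward (@measurable_snd_borel R X))//; last 2 first.
  - exact: measurable_funTS mf1.
  - by move=> x _; exact: f10.
  apply: ge0_subset_integral => //.
  - exact: measurable_snd_preimage.
  - exact: measurable_funTS.
  - by move=> p [].
apply: (@le_trans _ _ (2^-1%:E * (t%:E * \int[H]_(p in B0 `*` B1) f0 p.1 +
    t^-1%:E * \int[H]_(p in B0 `*` B1) f1 p.2))); last first.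
  rewrite lee_wpmul2l// leeD// lee_wpmul2l// lee_fin ?ltW// invr_gt0//.
have tV : (0 <= t^-1)%R by rewrite invr_ge0 ltW.
rewrite -!ge0_integralZl ?lee_fin ?(ltW t0)//; [|exact: measurable_funTS..].
rewrite -ge0_integralD//; last 4 first.
- by move=> p _; rewrite mule_ge0// lee_fin ltW.
- by apply: measurable_funeM; exact: measurable_funTS.
- by move=> p _; rewrite mule_ge0.
- by apply: measurable_funeM; exact: measurable_funTS.
have mS : measurable_fun (B0 `*` B1 : set (borel (X * X)%type))
    (fun p => t%:E * f0 p.1 + t^-1%:E * f1 p.2).
  by apply: emeasurable_funD; apply: measurable_funeM; exact: measurable_funTS.
have S0 (p : X * X) : 0 <= t%:E * f0 p.1 + t^-1%:E * f1 p.2.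
  by rewrite adde_ge0// mule_ge0// lee_fin ltW.
rewrite -ge0_integralZl ?lee_fin//.
(* The mass of the rectangle is the integral of 1, so the averaged integrand only has to be at least
   1 almost everywhere. *)
rewrite -[leLHS]mul1e -integral_cst//.
apply: ae_ge0_le_integral => //.
- by move=> p _; rewrite mule_ge0.
- exact: measurable_funeM.
have pos0 := ae_marg0 (density_gt0 Hmu0).
have pos1 := ae_marg1 (density_gt0 Hmu1).
apply: filterS (filterI (ae_density_mul_le1 Hmin) (filterI pos0 pos1)).
move=> p [d01 [d0 d1]] _; have {}d01 := d01 d0 d1.
rewrite /f0 /f1 !max_r ?invr_ge0 ?(ltW d0) ?(ltW d1)//.
(* AM-GM: t / u + 1 / (t v) >= 2 / sqrt (u v) >= 2 because u v <= 1 *)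
move: (density _ _ _) (density _ _ _) d0 d1 d01 => v u u0 v0 uv.
suff : (1 <= 2^-1 * (t * u^-1 + t^-1 * v^-1))%R by rewrite -lee_fin.
have u_neq0 := lt0r_neq0 u0; have v_neq0 := lt0r_neq0 v0.
have t_neq0 := lt0r_neq0 t0.
have -> : (2^-1 * (t * u^-1 + t^-1 * v^-1) =
  (t ^+ 2 * v + u) / (2 * t * u * v))%R.
  by field; rewrite u_neq0 v_neq0 t_neq0.
rewrite ler_pdivlMr ?mulr_gt0// mul1r.
(* This quantity and the next one add up to [t^2 v + u - 2 t u v]. *)
have : (0 <= v * (t - u) ^+ 2)%R by rewrite mulr_ge0 ?sqr_ge0// ltW.
have : (0 <= u * (1 - u * v))%R by rewrite mulr_ge0 ?subr_ge0// ltW.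
nra.
Qed.

Lemma rectangle_bound (B0 B1 : set (borel X)) :
  measurable B0 -> measurable B1 ->
  H (B0 `*` B1) <= sqrte (reduced_measure l mu0 mu1 B0 * reduced_measure l mu1 mu0 B1).
Proof.
move=> mB0 mB1.
pose C0 := B0 `&` reduced_set l mu1; pose C1 := B1 `&` reduced_set l mu0.
have mC0 : measurable (C0 : set (borel X)).
  by apply: measurableI => //; exact: measurable_reduced_set.
have mC1 : measurable (C1 : set (borel X)).
  by apply: measurableI => //; exact: measurable_reduced_set.
(* Almost every pair has its coordinates in the reduced sets, so cutting the rectangle down to them
   keeps its mass. *)
rewrite [X in X <= _](_ : _ = H (C0 `*` C1)); last first.
  have [N [mN N0 redN]] := ae_reduced sepX l_gt0 Hmin.
  have mBB := measurable_setX_borel mB0 mB1.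
  have mCC := measurable_setX_borel mC0 mC1.
  apply/eqP; rewrite eq_le; apply/andP; split; last first.
    by apply: le_measure; rewrite ?inE// => -[x y] [[] + _ [] + _].
  rewrite -[leRHS]adde0 -N0; apply: le_trans (measureU2 _ mCC mN).
  apply: le_measure; rewrite ?inE//; first exact: measurableU.
  move=> [x y] [/= Bx By].
  have [Nxy|nN] := pselect (N (x, y)); first by right.
  left; have [rx ry] : reduced_set l mu1 x /\ reduced_set l mu0 y.
    by apply: contrapT => h; apply: nN; exact: redN.
  exact: (conj (conj Bx rx) (conj By ry)).
have h01 := rectangle_scaled_mean _ mC0 mC1.
(* A reduced measure of [B0] or [B1] is by definition the original measure of [C0] or [C1]. *)
change (H (C0 `*` C1) <= sqrte (mu0 C0 * mu1 C1)).
have : H (C0 `*` C1) \is a fin_num.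
  by apply: fin_num_measure; exact: measurable_setX_borel.
have : mu0 C0 \is a fin_num by exact: fin_num_measure.
have : mu1 C1 \is a fin_num by exact: fin_num_measure.
have : 0 <= H (C0 `*` C1) by exact: measure_ge0.
have : 0 <= mu0 C0 by exact: measure_ge0.
have : 0 <= mu1 C1 by exact: measure_ge0.
move: h01; move: (H _) (mu0 C0) (mu1 C1) => [h||] [m0||] [m1||]//= h01.
rewrite !lee_fin => m10 m00 h0 _ _ _.
apply: le_sqrt_of_scaled_mean => // t t0.
have := h01 t t0.
rewrite [X in _ <= X](_ : _ = (2^-1 * (t * m0 + t^-1 * m1))%:E)//.
by rewrite lee_fin [leRHS]mulrC.
Qed.

End rectangle.

Theorem lemma4p3 (R : realType) (X : completeMetricType R)
    (sepX : separable_space X) (geoX : geodesic_space X)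
    (l : R) (l_gt0 : (0 < l)%R)
    (mu0 mu1 : borel_fmeasure R X) (H : borel_fmeasure R (X * X)%type)
    (Hmin : LET_minimizer l mu0 mu1 H) :
  let mu0' := reduced_measure l mu0 mu1 in
  let mu1' := reduced_measure l mu1 mu0 in
  [/\ H setT <= sqrte (mu0' setT * mu1' setT),
      sqrte (mu0' setT * mu1' setT) <= sqrte (mu0 setT * mu1 setT),
      forall A : set (borel X), measurable A ->
        H (A `*` setT) <=
          sqrte (mu0' A * completed mu1' (thickening A (pi / (2 * l))%R)) &
      forall (d : nat) (iota : X -> 'rV[R]_d),
        (forall x y : X, mdist x y = euclidean_dist (iota x) (iota y)) ->
        pushforward mu0 (iota : borel X -> borel 'rV[R]_d)
          `<< @lebesgue_rV R d ->
        pushforward mu1 (iota : borel X -> borel 'rV[R]_d)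
          `<< @lebesgue_rV R d ->
        forall T : X -> X,
          [set p : X * X | p.2 = T p.1] = msupport H ->
          forall A : set (borel X), measurable A ->
            completed H (A `*` (T @` A)) <=
              sqrte (mu0' A * completed mu1' (T @` A))].
Proof.
move=> mu0' mu1'.
have bound (B0 B1 : set (borel X)) : measurable B0 -> measurable B1 ->
    H (B0 `*` B1) <= sqrte (mu0' B0 * mu1' B1).
  exact: (rectangle_bound sepX l_gt0 Hmin).
split.
- by rewrite -setXTT; exact: bound.
- rewrite lee_sqrt ?mule_ge0//.
  by apply: lee_pmul => //; apply: le_measure; rewrite ?inE// setTI;
    exact: measurable_reduced_set.
(* The thickening is measured by the outer measure, so the estimate is proved for each Borel set [B]
   containing it. *)
- move=> A mA; apply: le_sqrt_outer => //.
  + by apply: fin_num_measure; exact: measurable_setX_borel.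
  + exact: fin_num_measure.
  move=> B mB AB; rewrite (le_trans _ (bound A B mA mB))//.
  have [N [mN N0 NH]] := ae_mdist_lt Hmin.
  have mAT := measurable_setX_borel mA (@measurableT _ (borel X)).
  have mAB := measurable_setX_borel mA mB.
  rewrite -[leRHS]adde0 -N0; apply: le_trans (measureU2 _ mAB mN).
  apply: le_measure; rewrite ?inE//; first exact: measurableU.
  move=> [x y] [/= Ax _].
  have [Nxy|nN] := pselect (N (x, y)); first by right.
  (* Off the null set [N], the bound [l * mdist x y < pi / 2] places [y] in the thickening of [A],
     hence in [B]. *)
  left; split => //=; apply: AB; exists x => //.
  have : (l * mdist x y < pi / 2)%R.
    by apply: contrapT => h; apply: nN; exact: NH.
  rewrite -ltr_pdivlMl// => /ltW; congr (_ <= _)%R.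
  by field; rewrite gt_eqF.
- move=> d iota _ _ _ T _ A mA.
  have fin_out : completed H (A `*` (T @` A)) \is a fin_num.
    rewrite ge0_fin_numE; last exact: mu_ext_ge0.
    apply: le_lt_trans (le_mu_ext H (@subsetT _ _)) _.
    by rewrite measurable_mu_extE// ltey_eq fin_num_measure.
  apply: le_sqrt_outer => //.
  + exact: fin_num_measure.
  (* A Borel set [B] containing the image of [A] gives a Borel rectangle containing the set in
     question, and there the outer measure is [H] itself. *)
  move=> B mB TB; rewrite (le_trans _ (bound A B mA mB))//.
  rewrite -(measurable_mu_extE H (measurable_setX_borel mA mB)).
  by apply: le_mu_ext => -[x y] [Ax Ty]; split => //; exact: TB.
Qed.
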